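(* Let $\{V_{m,j}\}$ be the $[0,1]$-valued random variables driving a quantile pyramid, with associated level-$m$ functions $Q_m$, derivatives $q_m$, and limit $Q$. Let $\mathcal F_{m-1}$ represent all variables $V_{m',j'}$ with $m'\le m-1$. Assume that $\mathrm E(V_{m,j}\mid\mathcal F_{m-1})=\tfrac12$ and $\mathrm{Var}(V_{m,j}\mid\mathcal F_{m-1})\le\sigma_m^2$ for each $m\ge1$ and each $j\in\{1,3,\dots,2^m-1\}$, where the constants $\sigma_m^2$ satisfy $\sum_{m=1}^\infty\sigma_m^2<\infty$. Then with probability $1$ there is a function $q(y)$ on $[0,1]$ which is the almost everywhere (in $y$) limit of $q_m(y)$ as $m\to\infty$, and for which $Q(y)=\int_0^y q(u)\,du$ for all $0\le y\le1$.
   Context: Quantile pyramid: for each $m\ge1$ and $j\in\{1,3,5,\dots,2^m-1\}$ let $V_{m,j}$ be a $[0,1]$-valued random variable. For each $m$, the variables $V_{m,j}$ ($j$ odd) are conditionally independent given all variables $V_{m',j'}$ with $m'\le m-1$ from earlier levels (they are allowed to depend on these). Recursively, at level $m$, $Q_m$ agrees with $Q_{m-1}$ at the points $i/2^{m-1}$, $0\le i\le 2^{m-1}$ (for $m=1$ the level-$0$ function is taken to be the identity, so $Q_1(0)=0$, $Q_1(1)=1$), and for odd $j$ $$Q_m(j/2^m)=Q_{m-1}((j-1)/2^m)(1-V_{m,j})+Q_{m-1}((j+1)/2^m)V_{m,j}.$$ $Q_m$ is extended to all of $[0,1]$ by linear interpolation between the points $j/2^m$, $0\le j\le 2^m$.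 Its derivative, defined outside the points $j/2^m$, is $$q_m(y)=\{Q_m(j/2^m)-Q_m((j-1)/2^m)\}/(\tfrac12)^m\quad\text{for } y\in((j-1)/2^m,j/2^m).$$ $Q$ denotes the limiting quantile process, $Q(y)=\lim_{m\to\infty}Q_m(y)$ (at a dyadic point $y=j/2^m$ it equals $Q_m(j/2^m)$, since this value does not change at later levels). *)

(* Defs.v *)
From HB Require Import structures.
From mathcomp Require Import all_boot all_order all_algebra.
From mathcomp Require Import finmap.
From mathcomp Require Import all_classical all_reals all_analysis.

Set Implicit Arguments.
Unset Strict Implicit.
Unset Printing Implicit Defensive.

Import Order.TTheory GRing.Theory Num.Theory.
Import numFieldNormedType.Exports.

Local Open Scope classical_set_scope.
Local Open Scope ring_scope.

(** [cond_expectation P G X Z]: the real function [Z] is a version of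
    [E(X | G)].  The set system [G] is meant to be a sub-sigma-algebra of the
    measurable sets of [T]. *)
Definition cond_expectation (R : realType) (d : measure_display)
    (T : measurableType d) (P : probability T R) (G : set (set T))
    (X Z : T -> R) : Prop :=
  [/\ P.-integrable setT (EFin \o X),
      P.-integrable setT (EFin \o Z),
      (forall B : set R, measurable B -> G (Z @^-1` B)) &
      (forall A : set T, G A ->
         (\int[P]_(w in A) (Z w)%:E = \int[P]_(w in A) (X w)%:E)%E)].

(** [cond_variance P G X W]: [W] is a version of
    [Var(X | G) = E((X - E(X | G))^2 | G)]. *)
Definition cond_variance (R : realType) (d : measure_display)
    (T : measurableType d) (P : probability T R) (G : set (set T))
    (X W : T -> R) : Prop :=
  exists2 M : T -> R, cond_expectation P G X M &
    cond_expectation P G (fun w => (X w - M w) ^+ 2) W.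

(** The family [X i], [i \in D], is (mutually) conditionally independent given
    [G]: conditional probabilities of finite intersections factorize. *)
Definition cond_independent (R : realType) (d : measure_display)
    (T : measurableType d) (P : probability T R) (G : set (set T))
    (I : choiceType) (D : set I) (X : I -> T -> R) : Prop :=
  forall J : {fset I}, [set` J] `<=` D ->
  forall B : I -> set R, (forall i, measurable (B i)) ->
  exists2 p : I -> T -> R,
    (forall i, i \in J -> cond_expectation P G (\1_(X i @^-1` B i)) (p i)) &
    cond_expectation P G
      (\1_(\bigcap_(i in [set` J]) (X i @^-1` B i)))
      (fun w => \prod_(i <- J) p i w).

(** The indices [(m, j)] at which the pyramid has a variable [V m j]; the
    values of [V] at other pairs of natural numbers play no role. *)
Definition pyramid_index (m j : nat) : bool :=
  [&& (1 <= m)%N, odd j & (j < 2 ^ m)%N].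

(** The sigma-algebra generated by the variables of levels [<= n]. *)
Definition pyramid_history (R : realType) (T : Type)
    (V : nat -> nat -> T -> R) (n : nat) : set (set T) :=
  <<s [set A | exists m j, [/\ (m <= n)%N, pyramid_index m j &
                 preimage_set_system setT (V m j) measurable A]] >>.

(** Linear interpolation of the values [a j] at the points [j / 2 ^ m]. *)
Definition dyadic_interpolation (R : realType) (m : nat) (a : nat -> R)
    (y : R) : R :=
  let k := Num.truncn (y * 2 ^+ m) in
  a k + (y * 2 ^+ m - k%:R) * (a k.+1 - a k).

(** [Q_m] on [0, 1] for one realization [v] of the variables; only the values
    at [y] in [0, 1] are meaningful. *)
Fixpoint quantile_level (R : realType) (v : nat -> nat -> R) (m : nat)
    (y : R) {struct m} : R :=
  match m with
  | 0%N => y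
  | m'.+1 =>
    let Qprev := quantile_level v m' in
    dyadic_interpolation m'.+1
      (fun j => if odd j then
                  Qprev (j.-1%:R / 2 ^+ m'.+1) * (1 - v m'.+1 j) +
                  Qprev (j.+1%:R / 2 ^+ m'.+1) * v m'.+1 j
                else Qprev (j%:R / 2 ^+ m'.+1)) y
  end.

(** [q_m]: the slope of [Q_m] on the dyadic interval of level [m] containing
    [y].  At the points [j / 2 ^ m] it gets the slope to the right, a harmless
    convention since these are Lebesgue-negligible. *)
Definition quantile_density_level (R : realType) (v : nat -> nat -> R)
    (m : nat) (y : R) : R :=
  let k := Num.truncn (y * 2 ^+ m) in
  (quantile_level v m (k.+1%:R / 2 ^+ m) -
   quantile_level v m (k%:R / 2 ^+ m)) / (2^-1) ^+ m.

Definition quantile_limit (R : realType) (v : nat -> nat -> R) (y : R) : R :=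
  limn (fun m => quantile_level v m y).

(** The variables [V m j] drive a quantile pyramid. *)
Definition quantile_pyramid (R : realType) (d : measure_display)
    (T : measurableType d) (P : probability T R)
    (V : nat -> nat -> {RV P >-> R}) : Prop :=
  (forall m j, pyramid_index m j -> forall w, 0 <= V m j w <= 1) /\
  (forall m, (1 <= m)%N ->
     cond_independent P (pyramid_history V m.-1)
       [set j | pyramid_index m j] (V m)).

(* Main.v *)
(** Fix a realization of the variables.  The slopes of [Q_m] are the averages
    of the slopes of [Q_(m+1)] over the two halves of each dyadic interval, so
    the [q_m] form a martingale on [0, 1] for the dyadic filtration: their
    energies [M_m = int q_m^2] increase and [int (q_m - q_n)^2 = M_m - M_n] for
    [n <= m].  If the energies are bounded, then a subsequence of the [q_m]
    converges in L^1 to some [q]; hence [Q_m (k / 2^m)] is the integral of [q]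
    over [0, k / 2^m], the monotonicity of [Q_m] gives [Q_m -> int_0^y q], and
    [q_m -> q] almost everywhere by the Lebesgue differentiation theorem.

    It remains to bound the energies almost surely.  Splitting an interval
    multiplies its energy by [1 + 4 (V - 1/2)^2], so the assumptions on the
    conditional mean and variance give
    [E M_m <= (1 + 4 sigma_m^2) E M_(m-1)], whence
    [E (sup_m M_m) <= exp (4 sum_m sigma_m^2)] by monotone convergence. *)

Require Import Defs.
From HB Require Import structures.
From mathcomp Require Import all_boot all_order all_algebra.
From mathcomp Require Import finmap.
From mathcomp Require Import all_classical all_reals all_analysis.
From mathcomp Require Import measurable_realfun.
From mathcomp Require Import ring lra.

Set Implicit Arguments.
Unset Strict Implicit.
Unset Printing Implicit Defensive.

Import Order.TTheory GRing.Theory Num.Theory.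
Import numFieldNormedType.Exports.

Local Open Scope classical_set_scope.
Local Open Scope ring_scope.

(** * Dyadic values, slopes and energies of one realization *)

Fixpoint node (R : realType) (v : nat -> nat -> R) (m k : nat) : R :=
  match m with
  | 0%N => k%:R
  | m'.+1 =>
    if odd k then
      node v m' k./2 * (1 - v m k) + node v m' k./2.+1 * v m k
    else node v m' k./2
  end.

Definition slope (R : realType) (v : nat -> nat -> R) (m k : nat) : R :=
  (node v m k.+1 - node v m k) * 2 ^+ m.

(** This is the integral of the square of [quantile_density_level v m] over [0, 1]. *)
Definition energy (R : realType) (v : nat -> nat -> R) (m : nat) : R :=
  (\sum_(k < 2 ^ m) slope v m k ^+ 2) / 2 ^+ m.

Definition pyramid_weights (R : realType) (v : nat -> nat -> R) : Prop :=
  forall m j, pyramid_index m j -> 0 <= v m j <= 1.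

Section dyadic_nodes.
Variables (R : realType) (v : nat -> nat -> R).

Lemma truncn_dyadic m k : Num.truncn (k%:R / 2 ^+ m * 2 ^+ m : R) = k.
Proof. by rewrite divfK ?expf_neq0 ?pnatr_eq0// natrK. Qed.

Lemma half_dyadic m k : k.*2%:R / 2 ^+ m.+1 = k%:R / 2 ^+ m :> R.
Proof. by rewrite -mul2n natrM exprS invfM mulrACA divff ?mul1r// pnatr_eq0. Qed.

(** [node] runs the pyramid recursion on integer indices alone; real division and truncation are
    dealt with here once and for all. *)
Lemma quantile_levelE m y : let k := Num.truncn (y * 2 ^+ m) in
  quantile_level v m y =
  node v m k + (y * 2 ^+ m - k%:R) * (node v m k.+1 - node v m k).
Proof.
elim: m y => [|m IH] y /=.
  by rewrite expr0 mulr1 -natr1 [X in _ * X]addrC addKr mulr1 subrKC.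
have Q_node k : quantile_level v m (k%:R / 2 ^+ m) = node v m k.
  by rewrite IH truncn_dyadic divfK ?expf_neq0 ?pnatr_eq0// subrr mul0r addr0.
(* For odd [j] both neighbours are even, so in every case [quantile_level v m] is read at a dyadic
   point of level [m], where [Q_node] applies. *)
have nodeE j : (if odd j then
      quantile_level v m (j.-1%:R / 2 ^+ m.+1) * (1 - v m.+1 j) +
      quantile_level v m (j.+1%:R / 2 ^+ m.+1) * v m.+1 j
    else quantile_level v m (j%:R / 2 ^+ m.+1)) = node v m.+1 j.
  rewrite /=; case: ifPn => oj.
    have jE : j = j./2.*2.+1 by rewrite -{1}(odd_double_half j) oj.
    by rewrite {1 3}jE -doubleS [_.-1]/= !half_dyadic !Q_node.
  have jE : j = j./2.*2 by rewrite -{1}(odd_double_half j) (negbTE oj).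
  by rewrite {1}jE half_dyadic Q_node.
rewrite /dyadic_interpolation.
move: (Num.truncn _) => k; by rewrite !nodeE.
Qed.

Lemma quantile_level_node m k : quantile_level v m (k%:R / 2 ^+ m) = node v m k.
Proof.
rewrite quantile_levelE truncn_dyadic divfK ?expf_neq0 ?pnatr_eq0//.
by rewrite subrr mul0r addr0.
Qed.

Lemma quantile_density_levelE m y :
  quantile_density_level v m y = slope v m (Num.truncn (y * 2 ^+ m)).
Proof.
rewrite /quantile_density_level /slope; set k := Num.truncn _.
by rewrite !quantile_level_node exprVn invrK.
Qed.

Lemma node_double m n k : node v (m + n) (k * 2 ^ n) = node v m k.
Proof.
elim: n => [|n IH]; first by rewrite addn0 muln1.
by rewrite addnS expnS mulnCA mul2n /= odd_double doubleK.
Qed.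

Lemma slope_double m k : slope v m.+1 k.*2 = 2 * v m.+1 k.*2.+1 * slope v m k.
Proof.
rewrite /slope /= odd_double /= doubleK uphalf_double exprS; ring.
Qed.

Lemma slope_doubleS m k :
  slope v m.+1 k.*2.+1 = 2 * (1 - v m.+1 k.*2.+1) * slope v m k.
Proof.
rewrite /slope /= odd_double /= uphalf_double doubleK exprS; ring.
Qed.

Lemma sum_double (f : nat -> R) n :
  \sum_(k < n.*2) f k = \sum_(k < n) (f k.*2 + f k.*2.+1).
Proof.
elim: n => [|n IH]; first by rewrite !big_ord0.
by rewrite doubleS !big_ord_recr /= IH addrA.
Qed.

(** The squared L^2 distance on [0, 1] from the density of level [m] to the step function with
    values [c k]. Leaving [c] free covers both the energy ([c = 0]) and the distance to an earlier
    density. *)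
Definition energy_gap m (c : nat -> R) :=
  (\sum_(k < 2 ^ m) (slope v m k - c k) ^+ 2) / 2 ^+ m.

(** Splitting interval [k] adds 4 (V - 1/2)^2 times its own energy. *)
Definition energy_step m :=
  (\sum_(k < 2 ^ m) slope v m k ^+ 2 * (v m.+1 k.*2.+1 - 2^-1) ^+ 2) * 4 / 2 ^+ m.

(* The slopes of level [m] are the averages of the slopes of level [m.+1] on
   the two halves, so the cross terms cancel whatever [c] is. *)
Lemma energy_gapS m (c : nat -> R) :
  energy_gap m.+1 (fun k => c k./2) = energy_gap m c + energy_step m.
Proof.
rewrite /energy_gap /energy_step expnS mul2n.
rewrite (sum_double (fun k => (slope v m.+1 k - c k./2) ^+ 2)).
rewrite -mulrDl [X in _ + X]mulr_suml -big_split /= exprS invfM mulrA; congr (_ / _).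
rewrite mulr_suml; apply: eq_bigr => k _.
rewrite slope_double slope_doubleS doubleK uphalf_double.
by field.
Qed.

Lemma energy_gap0 m : energy_gap m (fun=> 0) = energy v m.
Proof.
by rewrite /energy_gap /energy; congr (_ / _); apply: eq_bigr => k _; rewrite subr0.
Qed.

Lemma energyS m : energy v m.+1 = energy v m + energy_step m.
Proof. by rewrite -!energy_gap0 -energy_gapS. Qed.

(** Pythagoras for the dyadic martingale: interval [k] of level [n + i] lies in interval
    [k %/ 2 ^ i] of level [n], and each refinement raises the gap and the energy by the same
    [energy_step]. *)
Lemma energy_gapE n i :
  energy_gap (n + i) (fun k => slope v n (k %/ 2 ^ i)%N) =
  energy v (n + i) - energy v n.
Proof.
elim: i => [|i IH].
  rewrite addn0 subrr /energy_gap big1 ?mul0r// => k _.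
  by rewrite divn1 subrr expr0n.
rewrite addnS energyS addrAC -IH -energy_gapS /energy_gap.
congr (_ / _); apply: eq_bigr => k _.
by rewrite -divn2 -divnMA -expnS.
Qed.

Lemma energy_step_ge0 m : 0 <= energy_step m.
Proof.
by rewrite /energy_step !mulr_ge0 ?invr_ge0 ?exprn_ge0 ?sumr_ge0// => k _;
  rewrite mulr_ge0 ?sqr_ge0.
Qed.

Lemma energy_nondecreasing : {homo energy v : m n / (m <= n)%N >-> m <= n}.
Proof.
apply: homo_leq => // [|m]; first by move=> ? ? ?; exact: le_trans.
by rewrite energyS lerDl energy_step_ge0.
Qed.

Lemma energy0 : energy v 0 = 1.
Proof. by rewrite /energy expn0 big_ord1 /slope /= subr0 !mulr1 expr1n divr1. Qed.

Hypothesis v01 : pyramid_weights v.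

Lemma node_leS m k : (k < 2 ^ m)%N -> node v m k <= node v m k.+1.
Proof.
(* Monotonicity is proved on slopes, which each split multiplies by 2 V or 2 (1 - V), both
   nonnegative. *)
rewrite -subr_ge0 -(@pmulr_lge0 _ (2 ^+ m)) ?exprn_gt0// -/(slope v m k).
elim: m k => [|m IH] k km; first by rewrite /slope /= -natr1 addrC addKr mul1r.
have k2 : (k./2 < 2 ^ m)%N by rewrite ltn_half_double -mul2n -expnS.
have /andP[v0 v1] : 0 <= v m.+1 k./2.*2.+1 <= 1.
  apply: v01; rewrite /pyramid_index /= odd_double /= expnS mul2n.
  by rewrite ltn_Sdouble.
have := IH _ k2 => s0; rewrite -[k]odd_double_half.
case: (odd k) => /=; rewrite ?add1n ?add0n ?slope_doubleS ?slope_double.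
  by rewrite mulr_ge0// mulr_ge0// subr_ge0.
by rewrite mulr_ge0// mulr_ge0.
Qed.

End dyadic_nodes.

(** * Completeness of L^1 for sequences with summable increments *)

Section L1_completeness.
Local Open Scope ereal_scope.
Context d (T : measurableType d) (R : realType) (mu : {measure set T -> \bar R}).
Variables (D : set T) (mD : measurable D) (f : nat -> T -> R).
Hypothesis intf : forall n, mu.-integrable D (EFin \o f n).
Hypothesis sumf :
  \sum_(0 <= n <oo) \int[mu]_(x in D) `|(f n.+1 x - f n x)%:E| < +oo.

(** The sum [G] of the absolute increments is integrable, hence finite almost everywhere. There the
    sequence converges by telescoping, and |f 0| + [G] dominates it. *)
Lemma L1_fast_cauchy_cvg : exists q : T -> R, mu.-integrable D (EFin \o q) /\
  \int[mu]_(x in D) `|(f n x - q x)%:E| @[n --> \oo] --> 0.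
Proof.
have mf n : measurable_fun D (f n).
  exact/measurable_EFinP/(measurable_int _ (intf n)).
pose G x := \sum_(0 <= n <oo) `|(f n.+1 x - f n x)%:E|.
have mdf n : measurable_fun D (fun x => `|(f n.+1 x - f n x)%:E|).
  by do 2 apply: measurableT_comp => //; exact: measurable_funB.
have mG : measurable_fun D G by apply: ge0_emeasurable_sum.
have G0 x : 0 <= G x by apply: nneseries_ge0.
have iG : mu.-integrable D G.
  apply/integrableP; split => //.
  under eq_integral do rewrite gee0_abs//.
  by rewrite integral_nneseries.
have fE n x : f n x = (f 0%N x + \sum_(0 <= i < n) (f i.+1 x - f i x))%R.
  by rewrite telescope_sumr// subrKC.
have f_le n x : `|(f n x)%:E| <= `|(f 0%N x)%:E| + G x.
  rewrite fE EFinD (le_trans (lee_abs_add _ _))// leeD2l//.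
  rewrite -sumEFin (le_trans (lee_abs_sum _ _ _))//.
  exact: nneseries_lim_ge.
have f_cvg x : G x \is a fin_num -> cvgn (f ^~ x).
  move=> Gx; under eq_fun do rewrite fE.
  apply: is_cvgD; first exact: is_cvg_cst.
  apply: (@normed_cvg _ R^o); apply: nnseries_is_cvg => [i /=|]; first exact: normr_ge0.
  by move: Gx; rewrite ge0_fin_numE.
(* The upper limit is measurable without any convergence, and it equals the pointwise limit wherever
   [G] is finite. *)
pose qe x := limn_esup (fun n => (f n x)%:E).
have mqe : measurable_fun D qe.
  by apply: measurable_fun_limn_esup => n; exact/measurable_EFinP.
have qeE x : G x \is a fin_num -> qe x = (limn (f ^~ x))%:E.
  move=> Gx; rewrite /qe is_cvg_limn_esupE.
    by apply/cvg_lim => //; apply: cvg_EFin; [exact: nearW|exact: f_cvg].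
  by apply/cvg_ex; exists (limn (f ^~ x))%:E; apply: cvg_EFin;
    [exact: nearW|exact: f_cvg].
have [|||||iq dom _] := @dominated_convergence _ _ _ mu D mD
  (fun n x => (f n x)%:E) (fun x => (fine (qe x))%:E) (fun x => `|(f 0%N x)%:E| + G x).
- by move=> n; exact/measurable_EFinP.
- by apply/measurable_EFinP; exact: measurableT_comp.
- apply: filterS (integrable_ae mD iG) => x /[apply] Gx.
  by rewrite qeE//=; apply: cvg_EFin; [exact: nearW|exact: f_cvg].
- by apply: integrableD => //; exact: (integrable_abse (intf 0%N)).
- by apply: aeW => x n _; exact: f_le.
- exists (fine \o qe); split => //.
Qed.

End L1_completeness.

(** * Measurability and integrals of dyadic step functions *)

Section dyadic_steps.
Variable R : realType.
Local Notation mu := (@lebesgue_measure R).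

(** Composed with the embedding into the reals, truncation is monotone, hence measurable; a set of
    naturals is a countable union of points. *)
Lemma measurable_truncn : measurable_fun [set: R] (@Num.truncn R : R -> nat).
Proof.
move=> _ Y _; rewrite setTI.
have mnat : measurable_fun [set: R] (fun x : R => (Num.truncn x)%:R : R).
  by apply: nondecreasing_measurable => // x y xy; rewrite ler_nat le_truncn.
rewrite (_ : _ @^-1` Y =
    \bigcup_(k in Y) (fun x : R => (Num.truncn x)%:R : R) @^-1` [set k%:R]).
  by apply: bigcup_measurable => k _; rewrite -[X in measurable X]setTI; exact: mnat.
apply/seteqP; split => [x Yx|x [k Yk /= /eqP]]; first by exists (Num.truncn x).
by rewrite eqr_nat => /eqP ->.
Qed.

Lemma measurable_dyadic_step m (a : nat -> R) :
  measurable_fun [set: R] (fun y => a (Num.truncn (y * 2 ^+ m))).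
Proof.
apply: (measurableT_comp (f := a \o @Num.truncn R)) => //.
  exact: (measurableT_comp (f := a)) measurable_truncn.
exact: measurable_funM.
Qed.

Lemma integral_dyadic_step m (a : nat -> R) b :
  (\int[mu]_(y in `[0%R, (b%:R / 2 ^+ m)%R]) (a (Num.truncn (y * 2 ^+ m)))%:E =
   ((\sum_(k < b) a k) / 2 ^+ m)%:E)%E.
Proof.
have two_gt0 : 0 < 2 ^+ m :> R by rewrite exprn_gt0.
have mstep (D : set R) : measurable_fun D
    (fun y => (a (Num.truncn (y * 2 ^+ m)))%:E).
  by apply/measurable_EFinP/measurable_funTS; exact: measurable_dyadic_step.
(* With the null right endpoint removed, the domain is a disjoint union of half-open intervals on
   each of which the truncation is constant. *)
rewrite -integral_itv_bndo_bndc; last exact: mstep.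
elim: b => [|b IH]; first by rewrite big_ord0 !mul0r set_itvco0 integral_set0.
have ltb : b%:R / 2 ^+ m < b.+1%:R / 2 ^+ m :> R.
  by rewrite ltr_pM2r ?invr_gt0// ltr_nat.
rewrite (@itv_bndbnd_setU _ R _ (BLeft (b%:R / 2 ^+ m))); last 2 first.
- by rewrite bnd_simp divr_ge0// ltW.
- by rewrite bnd_simp ltW.
rewrite integral_setU//=; last 2 first.
- exact: mstep.
- apply/disj_setPS => y /=; rewrite !in_itv/= => -[/andP[_ yb] /andP[yb' _]].
  by have := lt_le_trans yb yb'; rewrite ltxx.
rewrite IH (eq_integral (cst (a b)%:E)); last first.
  move=> y; rewrite inE/= in_itv/= => /andP[by_ yb]; congr (a _)%:E.
  by apply: truncn_def; rewrite -ler_pdivrMr// by_ -ltr_pdivlMr.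
rewrite integral_cst//= lebesgue_measure_itv/= lte_fin ltb.
rewrite -EFinB -EFinM -EFinD big_ord_recr/=; congr EFin.
by rewrite -mulrBl -[b.+1]addn1 natrD addrAC subrr add0r mul1r mulrDl.
Qed.

Lemma integrable_dyadic_step m (a : nat -> R) :
  mu.-integrable `[0, 1] (EFin \o (fun y => a (Num.truncn (y * 2 ^+ m)))).
Proof.
apply/integrableP; split.
  by apply/measurable_EFinP/measurable_funTS; exact: measurable_dyadic_step.
have := @integral_dyadic_step m (fun k => `|a k|) (2 ^ m).
by rewrite natrX divff ?expf_neq0// => /= ->; rewrite ltry.
Qed.

(** Links the pointwise densities to the index [k %/ 2 ^ i] of [energy_gapE]. *)
Lemma truncn_divn (y : R) n i : 0 <= y ->
  Num.truncn (y * 2 ^+ n) = (Num.truncn (y * 2 ^+ (n + i)) %/ 2 ^ i)%N.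
Proof.
move=> y0; apply: truncn_def.
have := @truncn_itv _ (y * 2 ^+ (n + i)); rewrite mulr_ge0 ?exprn_ge0// => /(_ isT).
set k := Num.truncn _ => /andP[ky yk].
have i0 : 0 < 2 ^+ i :> R by rewrite exprn_gt0.
rewrite -(ler_pM2r i0) -[X in _ && X](ltr_pM2r i0) -!mulrA -exprD.
rewrite -natrX -!natrM (le_trans _ ky) ?ler_nat ?leq_trunc_div//=.
by rewrite (lt_le_trans yk)// ler_nat ltn_ceil// expn_gt0.
Qed.

End dyadic_steps.

(** * An L^1-convergent subsequence of densities under bounded energy *)

Section bounded_energy.
Variables (R : realType) (v : nat -> nat -> R).
Local Notation mu := (@lebesgue_measure R).
Local Notation q_ := (quantile_density_level v).

Lemma quantile_density_levelEfun m :
  q_ m = fun y => slope v m (Num.truncn (y * 2 ^+ m)).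
Proof. by apply/funext => y; exact: quantile_density_levelE. Qed.

Lemma integrable_density_level m : mu.-integrable `[0, 1] (EFin \o q_ m).
Proof. rewrite quantile_density_levelEfun; exact: integrable_dyadic_step. Qed.

(* AM-GM, [2 |x| <= c x^2 + 1 / c], replaces the Cauchy-Schwarz inequality. *)
Lemma density_level_gap n m c : (n <= m)%N -> 0 < c ->
  (\int[mu]_(y in `[0%R, 1%R]) `|(q_ m y - q_ n y)%:E| <=
   ((c * (energy v m - energy v n) + c^-1) / 2)%:E)%E.
Proof.
move=> nm c0; have -> : m = (n + (m - n))%N by rewrite subnKC.
move: (m - n)%N => i {nm m}; set m := (n + i)%N.
rewrite (@eq_integral _ _ _ mu `[0, 1]%classic (fun y : R =>
    (`|slope v m (Num.truncn (y * 2 ^+ m)) -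
       slope v n (Num.truncn (y * 2 ^+ m) %/ 2 ^ i)%N|)%:E)); last first.
  move=> y; rewrite inE/= in_itv/= => /andP[y0 _].
  by rewrite !quantile_density_levelE (@truncn_divn _ y n i).
have := @integral_dyadic_step R m
  (fun k => `|slope v m k - slope v n (k %/ 2 ^ i)%N|) (2 ^ m).
rewrite natrX divff ?expf_neq0// => ->; rewrite lee_fin.
rewrite -energy_gapE -/m /energy_gap.
(* The constant is spread over the [2 ^ m] intervals, so that the inequality can be checked term by
   term. *)
have -> : c^-1 = (\sum_(k < 2 ^ m) c^-1) / 2 ^+ m :> R.
  by rewrite sumr_const card_ord -(mulr_natr _ (2 ^ m)) natrX mulfK ?expf_neq0.
rewrite mulrA -mulrDl mulrAC ler_pM2r ?invr_gt0 ?exprn_gt0//.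
rewrite mulr_sumr -big_split/= mulr_suml; apply: ler_sum => k _.
set x := _ - _; rewrite ler_pdivlMr// -subr_ge0.
have -> : c * x ^+ 2 + c^-1 - `|x| * 2 = (c * `|x| - 1) ^+ 2 / c.
  by rewrite -[x ^+ 2]real_normK ?num_real//; field; rewrite gt_eqF.
by rewrite divr_ge0 ?sqr_ge0 ?ltW.
Qed.

Variable C : R.
Hypothesis energy_le : forall m, energy v m <= C.

Lemma energy_subsequence : exists phi : nat -> nat,
  [/\ {homo phi : i j / (i <= j)%N}, forall k, (k <= phi k)%N &
      forall k m, (phi k <= m)%N ->
        energy v m - energy v (phi k) <= (2^-1) ^+ k * (2^-1) ^+ k].
Proof.
have cvgE : cvgn (energy v).
  apply: nondecreasing_is_cvgn; first exact: energy_nondecreasing.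
  by exists C => _ [m _ <-].
have eps k : exists N, limn (energy v) - energy v N <= (2^-1) ^+ k * (2^-1) ^+ k :> R.
  have e0 : 0 < (2^-1) ^+ k * (2^-1) ^+ k :> R by rewrite mulr_gt0// exprn_gt0.
  move/cvgrPdist_le : (cvgE) => /(_ _ e0)[N _ /(_ N (leqnn N))] /=.
  by move=> /(le_trans (ler_norm _)); exists N.
have [psi psiP] := choice eps.
(* The partial sums make the choice monotone and at least [psi k]; the summand [k] makes it at least
   [k]. *)
exists (fun k => k + \sum_(i < k.+1) psi i)%N; split.
- apply: homo_leq => // [? ? ?|k]; first exact: leq_trans.
  by rewrite [in leqRHS]big_ord_recr/= addSnnS leq_add2l -addnS leq_addr.
- by move=> k; rewrite leq_addr.
- move=> k m km; rewrite (le_trans _ (psiP k))// lerB//.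
    apply: nondecreasing_cvgn_le => //; exact: energy_nondecreasing.
  apply: energy_nondecreasing.
  by rewrite big_ord_recr/= addnA leq_addl.
Qed.

Lemma density_subsequence : exists (phi : nat -> nat) (q : R -> R),
  [/\ forall k, (k <= phi k)%N, mu.-integrable `[0, 1] (EFin \o q) &
   (\int[mu]_(y in `[0%R, 1%R]) `|(q_ (phi k) y - q y)%:E|)%E @[k --> \oo] --> 0%E].
Proof.
have [phi [phi_homo phi_ge phi_gap]] := energy_subsequence.
have [|q [intq qcvg]] := @L1_fast_cauchy_cvg _ _ _ mu `[0, 1]%classic
  (measurable_itv _) (fun k => q_ (phi k)) (fun k => integrable_density_level (phi k)).
  have /cvg_lim halfE := @cvg_geometric_eseries_half R 2 0.
  apply: (@le_lt_trans _ _ (2 / 2 ^+ 0)%:E); last exact: ltry.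
  rewrite -halfE//; apply: lee_nneseries => [k _ _|k _ /=]; first exact: integral_ge0.
  (* Taking c = 2^k against a gap of at most 4^-k makes the bound of [density_level_gap] equal to
     2^-k, and these sum to 2. *)
  have k0 : 0 < 2 ^+ k :> R by rewrite exprn_gt0.
  apply: (le_trans (density_level_gap (phi_homo _ _ (leqnSn k)) k0)).
  rewrite lee_fin addn1 expnS natrM natrX invfM mulrA divff// mul1r.
  rewrite ler_pdivrMr// mulr_natr mulr2n lerD2r.
  apply: (le_trans (ler_wpM2l (ltW k0) (phi_gap _ _ (phi_homo _ _ (leqnSn k))))).
  by rewrite mulrA exprVn divff ?mul1r// gt_eqF.
by exists phi, q.
Qed.

End bounded_energy.

(** * Limits of the levels and densities for one realization *)

Section pathwise_limit.
Variables (R : realType) (v : nat -> nat -> R).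
Local Notation mu := (@lebesgue_measure R).
Local Notation q_ := (quantile_density_level v).

(** The endpoint is rewritten as a dyadic point of level [m], where the slopes telescope;
    [node_double] then returns to level [n]. *)
Lemma Rintegral_density_level m n k : (n <= m)%N ->
  \int[mu]_(y in `[0, k%:R / 2 ^+ n]) q_ m y = node v n k.
Proof.
move=> nm; have -> : m = (n + (m - n))%N by rewrite subnKC.
move: (m - n)%N => i {nm m}; set m := (n + i)%N.
have -> : k%:R / 2 ^+ n = (k * 2 ^ i)%:R / 2 ^+ m :> R.
  by rewrite natrM natrX /m exprD invfM mulrACA divff ?mulr1//.
rewrite /Rintegral quantile_density_levelEfun integral_dyadic_step/=.
rewrite -[RHS](node_double v n i k) -/m /slope -mulr_suml -mulrA.
rewrite divff ?expf_neq0// mulr1.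
rewrite -(big_mkord xpredT (fun j => node v m j.+1 - node v m j)).
rewrite telescope_sumr// [node v m 0](_ : _ = 0) ?subr0//.
by elim: {+}m => [|p IH] /=.
Qed.

Lemma quantile_level_bounds m y (k := Num.truncn (y * 2 ^+ m)) :
  pyramid_weights v -> 0 <= y < 1 ->
  node v m k <= quantile_level v m y <= node v m k.+1.
Proof.
move=> v01 /andP[y0 y1]; rewrite quantile_levelE -/k.
have y20 : 0 <= y * 2 ^+ m by rewrite mulr_ge0 ?exprn_ge0.
have /andP[ky yk] := truncn_itv y20.
have kS : node v m k <= node v m k.+1.
  apply: node_leS => //; rewrite -(ltr_nat R) natrX (le_lt_trans ky)//.
  by rewrite gtr_pMl// exprn_gt0.
rewrite lerDl mulr_ge0 ?subr_ge0//= -lerBrDl ler_piMl ?subr_ge0//.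
by rewrite lerBlDl natr1 ltW.
Qed.

Lemma dyadic_bounds m (y : R) : 0 <= y ->
  (Num.truncn (y * 2 ^+ m))%:R / 2 ^+ m <= y < (Num.truncn (y * 2 ^+ m)).+1%:R / 2 ^+ m.
Proof.
move=> y0; have m0 : 0 < 2 ^+ m :> R by rewrite exprn_gt0.
by rewrite ler_pdivrMr// ltr_pdivlMr// truncn_itv// mulr_ge0 ?exprn_ge0.
Qed.

Lemma dyadic_le1 m (y : R) : 0 <= y < 1 ->
  (Num.truncn (y * 2 ^+ m)).+1%:R / 2 ^+ m <= 1 :> R.
Proof.
move=> /andP[y0 y1]; have m0 : 0 < 2 ^+ m :> R by rewrite exprn_gt0.
rewrite ler_pdivrMr// mul1r -natrX ler_nat -(ltr_nat R) natrX.
rewrite (@le_lt_trans _ _ (y * 2 ^+ m)) ?truncn_le ?mulr_ge0 ?exprn_ge0//.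
by rewrite gtr_pMl.
Qed.

Lemma cvg_dyadic0 : (2^-1) ^+ m @[m --> \oo] --> (0 : R).
Proof. by apply: cvg_expr; rewrite ger0_norm ?invr_ge0// invf_lt1// ltr1n. Qed.

Section density.
Variable q : R -> R.
Hypothesis intq : mu.-integrable `[0, 1] (EFin \o q).
Hypothesis qE : forall n k, (k <= 2 ^ n)%N ->
  \int[mu]_(y in `[0, k%:R / 2 ^+ n]) q y = node v n k.
Local Notation F := (fun y => \int[mu]_(u in `[0, y]) q u).

(** Monotonicity squeezes the level between the values of [F] at the two ends of the dyadic interval
    around [y], and [F] is continuous. *)
Lemma quantile_level_cvg (y : R) : pyramid_weights v -> 0 <= y <= 1 ->
  quantile_level v m y @[m --> \oo] --> F y.
Proof.
move=> v01 /andP[y0]; rewrite le_eqVlt => /predU1P[->|y1].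
  (* The point 1 is separate because the dyadic interval starting there leaves [0, 1]; at 1 the
     levels are constant in [m]. *)
  apply: cvg_near_cst; apply: nearW => m.
  have -> : 1 = (2 ^ m)%:R / 2 ^+ m :> R by rewrite natrX divff ?expf_neq0.
  by rewrite quantile_level_node qE.
have y01 : 0 <= y < 1 by rewrite y0.
have contF := (@subspace_continuousP _ _ _ _).1
  (parameterized_integral_continuous ler01 intq).
(* [contF] gives continuity relative to [0, 1] only, so the approximating points must stay
   inside. *)
have Fcvg (a : nat -> R) : (forall m, 0 <= a m <= 1) ->
    (forall m, `|y - a m| <= (2^-1) ^+ m) -> F (a m) @[m --> \oo] --> F y.
  move=> a01 ya; have ay : a m @[m --> \oo] --> y.
    apply/cvgrPdist_le => e e0.
    move/cvgrPdist_le : cvg_dyadic0 => /(_ _ e0); apply: filterS => m.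
    rewrite sub0r normrN ger0_norm ?exprn_ge0 ?invr_ge0//.
    exact: le_trans.
  have := contF y; rewrite /= in_itv/= y0 ltW// => /(_ isT).
  apply: cvg_comp => A; rewrite /within/= => nA.
  have : \forall m \near \oo, `[0, 1]%classic (a m) -> A (a m) by exact: ay nA.
  by apply: filterS => m; apply; rewrite /= in_itv/=.
pose a m := (Num.truncn (y * 2 ^+ m))%:R / 2 ^+ m : R.
pose b m := (Num.truncn (y * 2 ^+ m)).+1%:R / 2 ^+ m : R.
have ba m : b m - a m = (2^-1) ^+ m.
  by rewrite -mulrBl -[_.+1]addn1 natrD addrAC subrr add0r mul1r exprVn.
have b1 m : b m <= 1 by exact: dyadic_le1.
have aP m : a m <= y by have /andP[] := dyadic_bounds m y0.
have bP m : y < b m by have /andP[] := dyadic_bounds m y0.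
have a0 m : 0 <= a m by rewrite divr_ge0 ?exprn_ge0.
apply: (@squeeze_cvgr _ _ _ _ (fun m => F (a m)) (fun m => F (b m))).
- apply: nearW => m; have km : (Num.truncn (y * 2 ^+ m) < 2 ^ m)%N.
    have := b1 m; rewrite /b ler_pdivrMr ?exprn_gt0// mul1r -natrX ler_nat.
    exact.
  rewrite !qE//; last exact: ltnW.
  exact: quantile_level_bounds.
- apply: Fcvg => m; first by rewrite a0 (le_trans (aP m))// ltW.
  by rewrite ger0_norm ?subr_ge0 ?aP// -(ba m) lerD2r ltW.
- apply: Fcvg => m; first by rewrite b1 (le_trans y0)// ltW.
  by rewrite distrC ger0_norm ?subr_ge0 ?(ltW (bP m))// -(ba m) lerD2l lerN2.
Qed.

(* [q_m y] is the mean of [q] over the dyadic interval of level [m] around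
   [y], so the Lebesgue differentiation theorem applies. *)
Lemma density_level_cvg :
  {ae mu, forall y, 0 <= y <= 1 -> q_ m y @[m --> \oo] --> q y}.
Proof.
(* The shrinking family is needed around every real point, negative ones included, hence
   [Num.floor]; [floorE] identifies it with truncation for the given [y]. *)
pose E (x : R) n := `[(Num.floor (x * 2 ^+ n))%:~R / 2 ^+ n,
  (Num.floor (x * 2 ^+ n) + 1)%:~R / 2 ^+ n[%classic : set R.
have n0 n : 0 < 2 ^+ n :> R by rewrite exprn_gt0.
have muE x n : mu (E x n) = ((2^-1) ^+ n)%:E.
  rewrite /E lebesgue_measure_itv/= lte_fin ltr_pM2r ?invr_gt0// ltr_int ltrDl ltr01.
  by rewrite -EFinB -mulrBl rmorphD/= addrAC subrr add0r mul1r exprVn.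
have r0 n : 0 < (2^-1) ^+ n :> R by rewrite exprn_gt0 ?invr_gt0.
have niceE x : nicely_shrinking x (E x).
  split=> [n|]; first exact: measurable_itv.
  (* The ball of radius 2^-n around [x] contains [E x n] and has twice its measure. *)
  exists (2, fun n => PosNum (r0 n)); split => //= [|n z|n].
  - exact: cvg_dyadic0.
  - have /andP[fx xf] := floor_itv (x * 2 ^+ n).
    rewrite /E/= in_itv/= ler_pdivrMr// ltr_pdivlMr// => /andP[fz zf].
    rewrite /ball/= exprVn -[X in _ < X]mul1r ltr_pdivlMr//.
    rewrite -(gtr0_norm (n0 n)) -normrM mulrBl ltr_distlC.
    move: xf zf; rewrite rmorphD/= => xf zf; apply/andP; split; lra.
  - by rewrite (lebesgue_measure_ball _ (ltW _))// muE -EFinM lee_fin mulr_natl.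
pose q01 := q \_ `[0, 1].
have locq : locally_integrable setT q01 by exact: integrable_locally.
(* At [y = 1] the intervals [E y n] lie outside [0, 1[, where [qE] says nothing; this point is
   null. *)
have ne1 : {ae mu, forall y : R, y != 1}.
  exists [set 1]; split => //; first exact: lebesgue_measure_set1.
  by move=> y /= /negP; rewrite negbK => /eqP.
have aeF := ae_filter_ringOfSetsType mu.
have := lebesgue_differentiation locq; apply: filterS2 ne1 => y y1 lebq y01.
have {y1}y01' : 0 <= y < 1 by move: y01 => /andP[-> yle1]; rewrite lt_neqAle y1.
have /andP[y0 y1] := y01'.
have floorE n : Num.floor (y * 2 ^+ n) = Num.truncn (y * 2 ^+ n).
  have y2 : 0 <= y * 2 ^+ n by rewrite mulr_ge0 ?exprn_ge0.
  rewrite truncn_floor y2 gez0_abs//; last by rewrite floor_ge0.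
have /fine_cvgP[_] := nice_lebesgue_differentiation niceE locq lebq.
rewrite /= /q01 patchE mem_set/= ?in_itv//=.
apply: cvg_trans; apply: near_eq_cvg; apply: nearW => n /=.
rewrite muE quantile_density_levelE /slope.
have -> : (\int[mu]_(x in E y n) (q01 x)%:E =
    (node v n (Num.truncn (y * 2 ^+ n)).+1 - node v n (Num.truncn (y * 2 ^+ n)))%:E)%E.
  set k := Num.truncn _.
  have kn : (k < 2 ^ n)%N.
    have := dyadic_le1 n y01'; rewrite -/k ler_pdivrMr// mul1r -natrX ler_nat.
    exact.
  have intqS (i : interval R) : [set` i] `<=` `[0, 1]%classic ->
      mu.-integrable [set` i] (EFin \o q).
    by move=> iS; apply: integrableS intq.
  have j01 j : (j <= 2 ^ n)%N -> j%:R / 2 ^+ n <= 1 :> R.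
    by move=> jn; rewrite ler_pdivrMr// mul1r -natrX ler_nat.
  have eqE j : (j <= 2 ^ n)%N ->
      (\int[mu]_(x in `[0%R, (j%:R / 2 ^+ n)%R[) (q x)%:E = (node v n j)%:E)%E.
    move=> jn; have S01 : `[0, j%:R / 2 ^+ n]%classic `<=` (`[0, 1]%classic : set R).
      by apply: subset_itvl; rewrite bnd_simp j01.
    rewrite integral_itv_bndo_bndc; last first.
      apply: (measurable_int mu); apply: intqS; apply: subset_trans S01.
      by apply: subset_itvl; rewrite bnd_simp.
    by rewrite -(qE jn) /Rintegral fineK// integrable_fin_num// intqS.
  have leab : k%:R / 2 ^+ n <= k.+1%:R / 2 ^+ n :> R.
    by rewrite ler_pM2r ?invr_gt0 ?n0// ler_nat.
  have k0 : 0 <= k%:R / 2 ^+ n :> R by rewrite divr_ge0 ?exprn_ge0.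
  have EE : E y n = `[k%:R / 2 ^+ n, k.+1%:R / 2 ^+ n[%classic.
    by rewrite /E floorE -/k -[k.+1]addn1 natrD rmorphD.
  rewrite (@eq_integral _ _ _ mu _ (EFin \o q)); last first.
    move=> x; rewrite EE inE/= in_itv/= => /andP[kx xk].
    rewrite /q01 patchE mem_set//= in_itv/= (le_trans k0)//=.
    by rewrite ltW// (lt_le_trans xk)// j01.
  rewrite EFinB -(eqE k.+1)//.
  rewrite (@itv_bndbnd_setU _ R _ (BLeft (k%:R / 2 ^+ n))) ?bnd_simp//.
  rewrite integral_setU//=; last 2 first.
  - apply: (measurable_int mu); rewrite -itv_bndbnd_setU ?bnd_simp//.
    by apply: intqS; apply: subset_itvl; rewrite bnd_simp j01.
  - apply/disj_setPS => x /=; rewrite !in_itv/= => -[/andP[_ xk] /andP[kx _]].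
    by have := lt_le_trans xk kx; rewrite ltxx.
  by rewrite (eqE k) 1?ltnW// addeAC subee// add0e EE.
by rewrite inver gt_eqF// exprVn invrK -EFinM/= mulrC.
Qed.

End density.

Lemma pathwise_quantile_density (C : R) : pyramid_weights v ->
  (forall m, energy v m <= C) ->
  exists q : R -> R,
    [/\ mu.-integrable `[0, 1] (EFin \o q),
        {ae mu, forall y : R, 0 <= y <= 1 -> q_ m y @[m --> \oo] --> q y} &
        forall y : R, 0 <= y <= 1 ->
          quantile_level v m y @[m --> \oo] --> quantile_limit v y /\
          quantile_limit v y = \int[mu]_(u in `[0, y]) q u].
Proof.
move=> v01 /density_subsequence[phi [q [phi_ge intq qcvg]]].
exists q; have qE n k : (k <= 2 ^ n)%N ->
    \int[mu]_(y in `[0, k%:R / 2 ^+ n]) q y = node v n k.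
  move=> kn; set A := [set` _].
  have mA : measurable A by exact: measurable_itv.
  have AS : A `<=` `[0, 1]%classic.
    apply: subset_itvl; rewrite bnd_simp ler_pdivrMr ?exprn_gt0//.
    by rewrite mul1r -natrX ler_nat.
  have intA f : mu.-integrable `[0, 1] (EFin \o f) -> mu.-integrable A (EFin \o f).
    by move=> intf; apply: integrableS intf => //; exact: measurable_itv.
  (* The distance between the two sides is independent of [j]. Once [phi j] reaches [n], it is at
     most the L^1 distance from the density of level [phi j] to [q], which tends to 0. *)
  apply/eqP; rewrite -subr_eq0 -normr_eq0 eq_le normr_ge0 andbT -lee_fin.
  apply: (cvge_to_ge qcvg); near=> j.
  have nj : (n <= phi j)%N.
    by rewrite (leq_trans _ (phi_ge j))//; near: j; exists n.
  rewrite -(Rintegral_density_level k nj) -/A distrC -RintegralB//; last 2 first.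
  - exact/intA/integrable_density_level.
  - exact: intA.
  have intB : mu.-integrable `[0, 1] (EFin \o (fun y => q_ (phi j) y - q y)).
    apply: (@integrableB _ _ _ mu _ _ (EFin \o q_ (phi j)) (EFin \o q)) => //.
    exact: integrable_density_level.
  rewrite EFin_normr_Rintegral//; last exact: (intA _ intB).
  have mB := measurable_int mu (intA _ intB).
  apply: (le_trans (le_abse_integral mu (measurable_itv _) mB)).
  apply: ge0_subset_integral => //.
  by apply: measurableT_comp => //; exact: (measurable_int mu intB).
split => [||y y01] //; first exact: density_level_cvg.
have Qcvg := quantile_level_cvg intq qE v01 y01.
by rewrite /quantile_limit (cvg_lim _ Qcvg).
Unshelve. all: by end_near. Qed.

End pathwise_limit.

(** * Integrals against weights measurable for a sub-sigma-algebra *)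

Section sub_sigma_algebra.
Local Open Scope ereal_scope.
Context d (T : measurableType d) (R : realType) (P : {measure set T -> \bar R}).
Variable S : set (set T).
Hypothesis S_measurable : <<s S >> `<=` measurable.

Lemma measurable_fun_sub_sigma d' (U : measurableType d')
    (h : g_sigma_algebraType S -> U) :
  measurable_fun setT h -> measurable_fun [set: T] (h : T -> U).
Proof. by move=> mh _ B mB; apply: S_measurable; exact: mh. Qed.

Import HBNNSimple.

(** A simple weight reduces the integral to finitely many integrals over its level sets, which
    belong to the sub-sigma-algebra. *)
Lemma integral_nnsfun_mul (h : {nnsfun (g_sigma_algebraType S) >-> R})
    (g : T -> \bar R) :
  measurable_fun [set: T] g -> (forall x, 0 <= g x) ->
  \int[P]_x ((h x)%:E * g x) =
  \sum_(y \in range h) y%:E * \int[P]_(x in h @^-1` [set y]) g x.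
Proof.
move=> mg g0.
pose ht : T -> R := h.
have mh y : measurable (ht @^-1` [set y]).
  by apply: S_measurable; rewrite -[X in <<s S >> X]setTI; exact: (measurable_funPT h).
have mind y : measurable_fun [set: T] (fun x => (y * \1_(ht @^-1` [set y]) x)%:E).
  by apply/measurable_EFinP; exact: measurable_funM.
have ind0 y x : 0 <= (y * \1_(ht @^-1` [set y]) x)%:E by exact: nnfun_muleindic_ge0.
transitivity (\int[P]_x (\sum_(y \in range h)
    ((y * \1_(ht @^-1` [set y]) x)%:E * g x))).
  apply: eq_integral => x _.
  rewrite -ge0_mule_fsuml => [|y]; last exact: ind0.
  by rewrite fsumEFin//; congr (_%:E * _); exact: fimfunE.
rewrite (@ge0_integral_fsum _ _ _ P _ measurableT _
  (fun y x => (y * \1_(ht @^-1` [set y]) x)%:E * g x))//; last 2 first.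
- by move=> y; exact: emeasurable_funM.
- by move=> y x _; rewrite mule_ge0.
apply: eq_fsbigr => y; rewrite inE => -[t _ <-].
under eq_integral do rewrite EFinM -muleA.
rewrite ge0_integralZl//.
- congr (_ * _); rewrite [RHS]integral_mkcond.
  by apply: eq_integral => x _; rewrite epatch_indic muleC.
- apply: emeasurable_funM => //; apply/measurable_EFinP.
  exact: measurable_indic.
- by move=> x _; rewrite mule_ge0.
- by rewrite lee_fin.
Qed.

(** Plays the part of taking a known factor out of a conditional expectation: simple weights are
    settled level set by level set, general ones by monotone convergence. *)
Lemma le_integral_sub_sigma (h f g : T -> R) :
  measurable_fun [set: g_sigma_algebraType S] h -> (forall x, (0 <= h x)%R) ->
  measurable_fun [set: T] f -> (forall x, (0 <= f x)%R) ->
  measurable_fun [set: T] g -> (forall x, (0 <= g x)%R) ->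
  (forall A, <<s S >> A ->
    \int[P]_(x in A) (f x)%:E <= \int[P]_(x in A) (g x)%:E) ->
  \int[P]_x (h x * f x)%:E <= \int[P]_x (h x * g x)%:E.
Proof.
move=> mh h0 mf f0 mg g0 fg.
have mhE : measurable_fun [set: g_sigma_algebraType S] (EFin \o h).
  exact/measurable_EFinP.
pose a := nnsfun_approx measurableT mhE.
(* The same simple functions, viewed on [T] with its full sigma-algebra, where [P] lives. *)
pose aT n : T -> R := a n.
have cvg_int (k : T -> R) : measurable_fun [set: T] k -> (forall x, (0 <= k x)%R) ->
    \int[P]_x ((aT n x)%:E * (k x)%:E) @[n --> \oo] --> \int[P]_x (h x * k x)%:E.
  move=> mk k0.
  rewrite (eq_integral (fun x => limn (fun n => (aT n x)%:E * (k x)%:E))); last first.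
    move=> x _; apply/esym/cvg_lim => //; rewrite EFinM; apply: cvgeZr => //.
    by apply: (cvg_nnsfun_approx measurableT mhE) => // y _; rewrite lee_fin.
  apply: cvg_monotone_convergence => //.
  - move=> n; apply: emeasurable_funM; last exact/measurable_EFinP.
    apply/measurable_EFinP.
    exact: (measurable_fun_sub_sigma (measurable_funPT (a n))).
  - by move=> n x _; rewrite mule_ge0 ?lee_fin//; exact: fun_ge0.
  - move=> x _ m n mn; rewrite lee_wpmul2r ?lee_fin//.
    by have /lefP := nd_nnsfun_approx measurableT mhE mn; exact.
apply: (lee_cvg_to (cvg_int _ mf f0) (cvg_int _ mg g0)); apply: nearW => n.
rewrite !integral_nnsfun_mul//; do ?exact/measurable_EFinP.
rewrite !fsbig_finite//= big_seq [leRHS]big_seq lee_sum// => y.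
rewrite in_fset_set// inE => -[t _ <-]; rewrite lee_wpmul2l ?lee_fin//.
apply: fg; rewrite -[X in <<s S >> X]setTI; exact: (measurable_funPT (a n)).
Qed.

End sub_sigma_algebra.

(** * Uniqueness of conditional expectations and the variance bound *)

Section conditional_variance.
Context d (T : measurableType d) (R : realType) (P : probability T R).
Variable S : set (set T).
Hypothesis S_measurable : <<s S >> `<=` measurable.

(** The set [A] where [Z1] exceeds [Z2] is in the sub-sigma-algebra, so [Z1 - Z2] integrates to 0
    over it; being positive there, it forces [A] to be null. *)
Lemma cond_expectation_ae_le (X Z1 Z2 : T -> R) :
  cond_expectation P <<s S >> X Z1 -> cond_expectation P <<s S >> X Z2 ->
  {ae P, forall w, Z1 w <= Z2 w}.
Proof.
move=> [_ iZ1 mZ1 Z1X] [_ iZ2 mZ2 Z2X].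
have mS1 : measurable_fun [set: g_sigma_algebraType S] Z1.
  by move=> _ B mB; rewrite setTI; exact: mZ1.
have mS2 : measurable_fun [set: g_sigma_algebraType S] Z2.
  by move=> _ B mB; rewrite setTI; exact: mZ2.
pose A := (Z1 \- Z2) @^-1` `]0, +oo[.
have SA : <<s S >> A.
  rewrite -[X in <<s S >> X]setTI.
  exact: (measurable_funB mS1 mS2 measurableT (measurable_itv _)).
have mA := S_measurable SA.
have iA Z : P.-integrable setT (EFin \o Z) -> P.-integrable A (EFin \o Z).
  by move=> iZ; apply: integrableS iZ.
have iB : P.-integrable A (EFin \o (Z1 \- Z2)).
  exact: (@integrableB _ _ _ P _ mA (EFin \o Z1) (EFin \o Z2) (iA _ iZ1) (iA _ iZ2)).
have : (\int[P]_(w in A) `|((Z1 \- Z2) w)%:E| = 0)%E.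
  rewrite (eq_integral (fun w => (Z1 w)%:E - (Z2 w)%:E)%E); last first.
    move=> w; rewrite inE /A /= in_itv/= andbT => /ltW Aw.
    by rewrite ger0_norm.
  rewrite integralB_EFin//; [|exact: iA|exact: iA].
  rewrite Z1X// Z2X// subee//; rewrite -Z1X//.
  by apply: integrable_fin_num => //; exact: iA.
move/(ae_eq_integral_abs P mA (measurable_int P iB)).
have aeF := ae_filter_ringOfSetsType P.
apply: filterS => w; rewrite /A /= in_itv/= andbT => Aw.
rewrite leNgt -subr_gt0; apply/negP => /[dup] Z12 /Aw [Z0].
by move: Z12; rewrite Z0 ltxx.
Qed.

Lemma cond_expectation_ae_unique (X Z1 Z2 : T -> R) :
  cond_expectation P <<s S >> X Z1 -> cond_expectation P <<s S >> X Z2 ->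
  {ae P, forall w, Z1 w = Z2 w}.
Proof.
move=> Z1P Z2P; have aeF := ae_filter_ringOfSetsType P.
apply: filterS2 (cond_expectation_ae_le Z1P Z2P) (cond_expectation_ae_le Z2P Z1P).
by move=> w le12 le21; apply/eqP; rewrite eq_le le12.
Qed.

(** [cond_variance] centres [X] at some version [M] of the conditional mean; uniqueness allows
    replacing it by the given [Z]. *)
Lemma cond_variance_le (X Z W : T -> R) (s : R) (A : set T) :
  measurable_fun setT X -> 0 <= s ->
  cond_expectation P <<s S >> X Z -> cond_variance P <<s S >> X W ->
  {ae P, forall w, W w <= s} -> <<s S >> A ->
  (\int[P]_(w in A) ((X w - Z w) ^+ 2)%:E <= \int[P]_(w in A) s%:E)%E.
Proof.
move=> mX s0 XZ [M XM [_ iW _ WX]] Ws SA; have mA := S_measurable SA.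
have aeF := ae_filter_ringOfSetsType P.
have mZ : measurable_fun setT Z.
  by case: XZ => _ iZ _ _; exact/measurable_EFinP/(measurable_int P iZ).
have mM : measurable_fun setT M.
  by case: XM => _ iM _ _; exact/measurable_EFinP/(measurable_int P iM).
have mW : measurable_fun A (EFin \o W).
  exact: measurable_funTS (measurable_int P iW).
have msq (Y : T -> R) : measurable_fun setT Y ->
    measurable_fun A (fun w => ((X w - Y w) ^+ 2)%:E).
  move=> mY; apply/measurable_funTS/measurable_EFinP/measurable_funX.
  exact: measurable_funB.
rewrite (@ae_eq_integral _ _ _ P A (fun w => ((X w - M w) ^+ 2)%:E))//; last first.
- by apply: filterS (cond_expectation_ae_unique XZ XM) => w -> _.
- exact: msq.
- exact: msq.
(* The sign of [W] is unknown, so its integral is bounded by that of its positive part, which is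
   still at most [s] almost everywhere because [s] is nonnegative. *)
rewrite -WX// integralE.
apply: (@le_trans _ _ (\int[P]_(w in A) ((EFin \o W)^\+ w))%E).
  by rewrite -[leRHS]sube0 leeB// integral_ge0.
apply: ae_ge0_le_integral => //.
- exact: measurable_funepos.
- apply: filterS Ws => w Ws _.
  by rewrite funeposE/= ge_max !lee_fin Ws.
Qed.

End conditional_variance.

(** * Almost sure boundedness of the energies *)

Section expected_energy.
Context d (T : measurableType d) (R : realType) (P : probability T R).
Variables (V : nat -> nat -> {RV P >-> R}) (sigma : nat -> R).
Local Notation vw := (fun w m j => V m j w).

(** The generating family of [pyramid_history V n], named so that [g_sigma_algebraType] can be
    formed from it. *)
Definition history_generators (n : nat) : set (set T) :=
  [set A | exists m j, [/\ (m <= n)%N, pyramid_index m j &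
    preimage_set_system setT (V m j) measurable A]].

Lemma history_measurable n : <<s history_generators n >> `<=` measurable.
Proof.
apply: smallest_sub; first exact: sigma_algebra_measurable.
move=> _ [m [j [_ _ [B mB <-]]]].
exact: (measurable_funPT (V m j)).
Qed.

Lemma history_homo n p : (n <= p)%N ->
  <<s history_generators n >> `<=` <<s history_generators p >>.
Proof.
move=> np; apply: smallest_sub; first exact: smallest_sigma_algebra.
move=> A [m [j [mn mj Amj]]]; apply: sub_sigma_algebra.
by exists m, j; split => //; exact: leq_trans np.
Qed.

Lemma measurable_node m k : (k <= 2 ^ m)%N ->
  measurable_fun [set: g_sigma_algebraType (history_generators m)]
    (fun w => node (vw w) m k).
Proof.
elim: m k => [|m IH] k km; first exact: measurable_cst.
have step j : (j <= 2 ^ m)%N ->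
    measurable_fun [set: g_sigma_algebraType (history_generators m.+1)]
      (fun w => node (vw w) m j).
  move=> jm _ B mB; apply: history_homo (leqnSn m) _ _.
  exact: IH.
have k2 : (k./2 <= 2 ^ m)%N by rewrite leq_half_double -mul2n -expnS leqW.
rewrite /=; case ok : (odd k); last exact: step.
have kE : k = k./2.*2.+1 by rewrite -{1}(odd_double_half k) ok.
have k2' : (k./2 < 2 ^ m)%N.
  by move: km; rewrite {1}kE expnS mul2n ltn_double.
have mV : measurable_fun [set: g_sigma_algebraType (history_generators m.+1)]
    (fun w => V m.+1 k w).
  move=> _ B mB; apply: sub_sigma_algebra; exists m.+1, k; split => //.
    by rewrite /pyramid_index ok/= {1}kE expnS mul2n ltn_Sdouble.
  by exists B.
apply: measurable_funD; apply: measurable_funM => //; do ?exact: step.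
exact: measurable_funB.
Qed.

(** Makes the squared slopes of level [m] admissible weights when conditioning the variables of
    level [m.+1]. *)
Lemma measurable_slope m k : (k < 2 ^ m)%N ->
  measurable_fun [set: g_sigma_algebraType (history_generators m)]
    (fun w => slope (vw w) m k).
Proof.
move=> km; apply: measurable_funM => //.
by apply: measurable_funB; apply: measurable_node => //; exact: ltnW.
Qed.

Lemma measurable_slopeT m k : (k < 2 ^ m)%N ->
  measurable_fun [set: T] (fun w => slope (vw w) m k).
Proof.
move=> /measurable_slope; exact/measurable_fun_sub_sigma/history_measurable.
Qed.

Lemma measurable_energy m : measurable_fun [set: T] (fun w => energy (vw w) m).
Proof.
apply: measurable_funM => //.
apply: measurable_sum => k; apply: measurable_funX; exact: measurable_slopeT.
Qed.

Lemma energy_ge0 w m : 0 <= energy (vw w) m.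
Proof. by rewrite divr_ge0 ?exprn_ge0// sumr_ge0// => k _; exact: sqr_ge0. Qed.

Hypothesis meanV : forall m j : nat, pyramid_index m j ->
  cond_expectation P (pyramid_history V m.-1) (V m j) (cst (2^-1)).
Hypothesis varV : forall m j : nat, pyramid_index m j ->
  exists2 W : T -> R,
    cond_variance P (pyramid_history V m.-1) (V m j) W &
    {ae P, forall w, W w <= sigma m ^+ 2}.

Lemma le_expected_energyS m :
  (\int[P]_w (energy (vw w) m.+1)%:E <=
   (1 + 4 * sigma m.+1 ^+ 2)%:E * \int[P]_w (energy (vw w) m)%:E)%E.
Proof.
(* The energy increment is the sum of the [h k * u k], where [h k] is known at level [m] and [u k]
   is the squared deviation of the new variable; the [h k] sum to four times the energy. *)
pose h (k : 'I_(2 ^ m)) w := 4 / 2 ^+ m * slope (vw w) m k ^+ 2.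
have h0 k w : 0 <= h k w by rewrite mulr_ge0 ?sqr_ge0// divr_ge0 ?exprn_ge0.
have mh k : measurable_fun [set: g_sigma_algebraType (history_generators m)] (h k).
  by apply: measurable_funM => //; apply: measurable_funX; exact: measurable_slope.
have mhT k : measurable_fun [set: T] (h k).
  by move: (mh k); exact/measurable_fun_sub_sigma/history_measurable.
pose u (k : 'I_(2 ^ m)) w := (V m.+1 k.*2.+1 w - 2^-1) ^+ 2.
have mu_ k : measurable_fun [set: T] (u k).
  by apply: measurable_funX; exact: measurable_funB.
have u0 k w : 0 <= u k w by exact: sqr_ge0.
have stepE w : energy_step (vw w) m = \sum_(k < 2 ^ m) h k w * u k w.
  rewrite /energy_step -mulrA mulr_suml; apply: eq_bigr => k _.
  by rewrite /h /u; ring.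
have hE w : \sum_(k < 2 ^ m) h k w * sigma m.+1 ^+ 2 =
    4 * sigma m.+1 ^+ 2 * energy (vw w) m.
  rewrite /energy mulr_suml mulr_sumr; apply: eq_bigr => k _.
  by rewrite /h; ring.
under eq_integral do rewrite energyS stepE EFinD.
rewrite ge0_integralD//; last 4 first.
- by move=> w _; rewrite lee_fin energy_ge0.
- exact/measurable_EFinP/measurable_energy.
- by move=> w _; rewrite lee_fin sumr_ge0// => k _; rewrite mulr_ge0.
- apply/measurable_EFinP/measurable_sum => k; exact: measurable_funM.
rewrite EFinD ge0_muleDl//; last by rewrite lee_fin mulr_ge0 ?sqr_ge0.
rewrite mul1e leeD2l//.
rewrite -ge0_integralZl//; last 3 first.
- exact/measurable_EFinP/measurable_energy.
- by move=> w _; rewrite lee_fin energy_ge0.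
- by rewrite lee_fin mulr_ge0 ?sqr_ge0.
under eq_integral do rewrite -sumEFin.
under [leRHS]eq_integral do rewrite -EFinM -hE -sumEFin.
rewrite !ge0_integral_sum//; last 4 first.
- by move=> k; apply/measurable_EFinP; exact: measurable_funM.
- by move=> k w _; rewrite lee_fin mulr_ge0 ?sqr_ge0.
- by move=> k; apply/measurable_EFinP; exact: measurable_funM.
- by move=> k w _; rewrite lee_fin mulr_ge0.
apply: lee_sum => k _.
apply: (@le_integral_sub_sigma _ _ _ _ _ (@history_measurable m) (h k) (u k)
  (cst (sigma m.+1 ^+ 2))) => // [w|A SA]; first exact: sqr_ge0.
have km : pyramid_index m.+1 k.*2.+1.
  by rewrite /pyramid_index /= odd_double/= expnS mul2n ltn_Sdouble.
have [W VW Ws] := varV km.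
apply: (cond_variance_le (@history_measurable m) _ _ (meanV km) VW Ws SA) => //.
exact: sqr_ge0.
Qed.

Lemma expected_energy_le m : (\int[P]_w (energy (vw w) m)%:E <=
  (expR (4 * \sum_(1 <= i < m.+1) sigma i ^+ 2))%:E)%E.
Proof.
elim: m => [|m IH].
  rewrite big_geq// mulr0 expR0; under eq_integral do rewrite energy0.
  by rewrite integral_cst//= probability_setT mule1.
rewrite big_nat_recr//= mulrDr expRD mulrC EFinM.
apply: (le_trans (le_expected_energyS m)); apply: lee_pmul => //.
- by rewrite lee_fin addr_ge0// mulr_ge0// sqr_ge0.
- by apply: integral_ge0 => w _; rewrite lee_fin energy_ge0.
- by rewrite lee_fin expR_ge1Dx.
Qed.

Lemma ae_bounded_energy : (\sum_(1 <= m <oo) (sigma m ^+ 2)%:E < +oo)%E ->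
  {ae P, forall w, exists C, forall m, energy (vw w) m <= C}.
Proof.
move=> sum_sigma.
pose S : R := fine (\sum_(1 <= m <oo) (sigma m ^+ 2)%:E)%E.
have sumE : (S%:E = \sum_(1 <= m <oo) (sigma m ^+ 2)%:E)%E.
  by rewrite fineK// ge0_fin_numE// nneseries_ge0// => m _ _; rewrite lee_fin sqr_ge0.
have le_sum m : \sum_(1 <= i < m.+1) sigma i ^+ 2 <= S.
  rewrite -lee_fin sumE -sumEFin.
  by apply: nneseries_lim_ge => i _ _; rewrite lee_fin sqr_ge0.
pose f m w := (energy (vw w) m)%:E.
have mf m : measurable_fun setT (f m) by exact/measurable_EFinP/measurable_energy.
have f0 m w : (0 <= f m w)%E by rewrite lee_fin energy_ge0.
have f_homo w : {homo f ^~ w : n m / (n <= m)%N >-> (n <= m)%E}.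
  by move=> n m nm; rewrite lee_fin energy_nondecreasing.
(* The energies increase with [m] for every [w], so this limit is their supremum. Its integral is
   finite by monotone convergence, so it is almost surely finite and serves as the bound [C]. *)
pose g w := limn (f ^~ w).
have fg w : f ^~ w @ \oo --> g w.
  by apply: ereal_nondecreasing_is_cvgn; exact: f_homo.
have g0 w : (0 <= g w)%E by apply: lime_ge; [exact: fg|exact: nearW].
have mg : measurable_fun setT g by apply: emeasurable_fun_cvg mf _ => w _; exact: fg.
have ig : P.-integrable setT g.
  apply/integrableP; split => //.
  under eq_integral do rewrite gee0_abs//.
  rewrite (monotone_convergence P measurableT mf)//.
  apply: (@le_lt_trans _ _ (expR (4 * S))%:E); last exact: ltry.
  apply: lime_le.
    apply: ereal_nondecreasing_is_cvgn => n m nm; apply: ge0_le_integral => //.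
    by move=> w _; exact: f_homo.
  apply: nearW => m; apply: (le_trans (expected_energy_le m)).
  by rewrite lee_fin ler_expR ler_pM2l.
have aeF := ae_filter_ringOfSetsType P.
apply: filterS (integrable_ae measurableT ig) => w /(_ I) gw.
exists (fine (g w)) => m; rewrite -lee_fin fineK//.
rewrite /g (cvg_lim _ (ereal_nondecreasing_cvgn (f_homo w)))//.
by apply: ereal_sup_ubound; exists m.
Qed.

End expected_energy.

Theorem proposition2p2 (R : realType) (d : measure_display)
    (T : measurableType d) (P : probability T R)
    (V : nat -> nat -> {RV P >-> R}) (sigma : nat -> R)
    (pyramidV : quantile_pyramid V)
    (meanV : forall m j : nat, pyramid_index m j ->
       cond_expectation P (pyramid_history V m.-1) (V m j) (cst (2^-1)))
    (varV : forall m j : nat, pyramid_index m j ->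
       exists2 W : T -> R,
         cond_variance P (pyramid_history V m.-1) (V m j) W &
         {ae P, forall w, W w <= sigma m ^+ 2})
    (sum_sigma : (\sum_(1 <= m <oo) (sigma m ^+ 2)%:E < +oo)%E) :
  {ae P, forall w,
    let v := fun m j => V m j w in
    exists q : R -> R,
      [/\ lebesgue_measure.-integrable `[0, 1] (EFin \o q),
          {ae lebesgue_measure, forall y : R, 0 <= y <= 1 ->
             quantile_density_level v m y @[m --> \oo] --> q y} &
          forall y : R, 0 <= y <= 1 ->
            quantile_level v m y @[m --> \oo] --> quantile_limit v y /\
            quantile_limit v y = \int[lebesgue_measure]_(u in `[0, y]) q u]}.
Proof.
case: pyramidV => v01 _; have aeF := ae_filter_ringOfSetsType P.
apply: filterS (ae_bounded_energy meanV varV sum_sigma) => w [C energy_le].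
by apply: pathwise_quantile_density energy_le => m j mj; exact: v01.
Qed.
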